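(* Let $f_{\mathrm{inv}}:\mathbb F_{2^{13}}\to\mathbb F_{2^{13}}$ be the multiplicative inverse function. Then $\mathcal K_{13}=\{3,4,\dots,10\}$; that is, for $1\le k\le 12$, $f_{\mathrm{inv}}$ is not $k$th order sum-free if and only if $3\le k\le 10$.
   Context: The multiplicative inverse function $f_{\mathrm{inv}}$ of $\mathbb F_{2^n}$ is defined by $f_{\mathrm{inv}}(x)=x^{-1}$ for $x\ne 0$ and $f_{\mathrm{inv}}(0)=0$. A function $f:\mathbb F_{2^n}\to\mathbb F_{2^n}$ is $k$th order sum-free if $\sum_{x\in A}f(x)\ne 0$ for every $k$-dimensional $\mathbb F_2$-affine subspace $A$ of $\mathbb F_{2^n}$. For $n\ge 2$, $\mathcal K_n=\{1\le k\le n-1: f_{\mathrm{inv}}\text{ is not $k$th order sum-free on }\mathbb F_{2^n}\}$. *)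

(* Defs.v *)
From HB Require Import structures.
From mathcomp Require Import all_boot all_order all_algebra all_field.

Set Implicit Arguments.
Unset Strict Implicit.
Unset Printing Implicit Defensive.

Import GRing.Theory.
Local Open Scope ring_scope.

Definition f_inv (F : finFieldType) (x : F) : F := if x == 0 then 0 else x^-1.

(* [pPrimeCharType charF] is [F] itself, seen as a vector space over ['F_2];
   so [U] below is an F_2-linear subspace of [F] and [\dim] is over F_2. *)
Definition affine_subspace (F : finFieldType) (charF : 2%N \in [pchar F])
    (k : nat) (A : {set F}) : Prop :=
  exists (a : F) (U : {vspace pPrimeCharType charF}),
    \dim U = k /\ A = [set a + u | u in U].

Definition sum_free (F : finFieldType) (charF : 2%N \in [pchar F])
    (k : nat) (f : F -> F) : Prop :=
  forall A : {set F}, affine_subspace charF k A -> \sum_(x in A) f x != 0.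

Lemma pchar_card2 (F : finFieldType) (n : nat) :
  #|F| = (2 ^ n)%N -> 2%N \in [pchar F].
Proof. by move=> /card_finPcharP; apply. Qed.

(* Membership [k \in K_n], where F_(2^n) is any field [F] with 2^n elements. *)
Definition in_K (n : nat) (F : finFieldType) (cardF : #|F| = (2 ^ n)%N)
    (k : nat) : Prop :=
  (1 <= k <= n.-1)%N /\ ~ sum_free (pchar_card2 cardF) k (@f_inv F).

(* Main.v *)
Require Import Defs.
From HB Require Import structures.
From mathcomp Require Import all_boot all_order all_algebra all_field.
From mathcomp Require Import ring.
Import GRing.Theory.
Local Open Scope ring_scope.

(* For a basis s of a subspace U, L(X) = \prod_(u in U) (X + u) is a linearized
   polynomial a0 X + a1 X^2 + ..., and taking logarithmic derivatives gives
   \sum_(u in U) 1/(x + u) = a0 / L(x) for x outside U, while the sum of 1/u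
   over the nonzero u in U is a1 / a0.  Affine subspaces avoiding 0 are therefore
   harmless, and k is in K_n iff a1 vanishes for some U of dimension k.  Adding w
   to the basis replaces L by L * (L + L(w)), hence a0 by a0 L(w) and a1 by
   a1 L(w) + a0^2.  For the whole field a1 = 0; comparing with it in codimensions
   1 and 2, or directly in dimensions 1 and 2, a1 = 0 would force a0 = 0 or a
   primitive cube root of unity, which F_(2^13) does not have.  For 3 <= k <= 10
   explicit bases, made of powers of a root of X^13 + X^4 + X^3 + X + 1, are
   checked by computation. *)

(* The operations are parameters, so that these recursions can also be run on
   bit vectors. *)
Section SubspacePolynomial.
Context {T : Type} (zero one : T) (add mul : T -> T -> T).

Fixpoint subspace_poly (s : seq T) (x : T) : T :=
  if s is w :: s' then
    let y := subspace_poly s' x in mul y (add y (subspace_poly s' w))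
  else x.

Fixpoint coef_X (s : seq T) : T :=
  if s is w :: s' then mul (coef_X s') (subspace_poly s' w) else one.

Fixpoint coef_X2 (s : seq T) : T :=
  if s is w :: s' then
    add (mul (coef_X2 s') (subspace_poly s' w)) (mul (coef_X s') (coef_X s'))
  else zero.
End SubspacePolynomial.

Lemma subspace_poly_morph (T U : Type) (f : T -> U) addT mulT addU mulU s x :
  {morph f : a b / addT a b >-> addU a b} ->
  {morph f : a b / mulT a b >-> mulU a b} ->
  f (subspace_poly addT mulT s x) = subspace_poly addU mulU (map f s) (f x).
Proof. by move=> fD fM; elim: s x => //= w s IHs x; rewrite fM fD !IHs. Qed.

Lemma coef_X_morph (T U : Type) (f : T -> U) oneT addT mulT addU mulU s :
  {morph f : a b / addT a b >-> addU a b} ->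
  {morph f : a b / mulT a b >-> mulU a b} ->
  f (coef_X oneT addT mulT s) = coef_X (f oneT) addU mulU (map f s).
Proof.
move=> fD fM; elim: s => //= w s IHs.
by rewrite fM IHs (subspace_poly_morph _ _ f _ _ addU mulU).
Qed.

Lemma coef_X2_morph (T U : Type) (f : T -> U) zeroT oneT addT mulT addU mulU s :
  {morph f : a b / addT a b >-> addU a b} ->
  {morph f : a b / mulT a b >-> mulU a b} ->
  f (coef_X2 zeroT oneT addT mulT s)
  = coef_X2 (f zeroT) (f oneT) addU mulU (map f s).
Proof.
move=> fD fM; elim: s => //= w s IHs.
rewrite fD !fM IHs (subspace_poly_morph _ _ f _ _ addU mulU) //.
by rewrite (coef_X_morph _ _ f _ _ _ addU mulU).
Qed.

(** * Sums of inverses over subspaces and their cosets *)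

Section InverseSums.
Context {F : finFieldType} (charF : 2%N \in [pchar F]).
Local Notation V := (pPrimeCharType charF).
Local Notation L := (@subspace_poly F +%R *%R).
Local Notation a0 := (@coef_X F 1 +%R *%R).
Local Notation a1 := (@coef_X2 F 0 1 +%R *%R).
Implicit Types (s : seq V) (x y w : V).

(** In characteristic 2 the map sending [p] to [p * (p + r)] is additive: the cross term occurs
    twice. *)
Lemma subspace_polyD s x y : L s (x + y) = L s x + L s y.
Proof.
elim: s x y => [//|w s IHs] x y /=; rewrite !IHs.
move: (L s x) (L s y) (L s w) => p q r.
have -> : (p + q) * (p + q + r) = p * (p + r) + q * (q + r) + (p * q + p * q).
  by ring.
by rewrite (addrr_pchar2 charF) addr0.
Qed.

(** The only scalars are 0 and 1, so adjoining [w] yields the old span and its translate by [w]. *)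
Lemma mem_span_cons w s x :
  (x \in <<w :: s>>%VS) = (x \in <<s>>%VS) || (x + w \in <<s>>%VS).
Proof.
rewrite span_cons; apply/idP/orP=> [/memv_addP[u /vlineP[k ->] [v vs ->]]|].
  case: k => [] [|[|//]] lt_k2.
    by left; rewrite (_ : Ordinal _ = 0) ?scale0r ?add0r //; apply: val_inj.
  right; rewrite (_ : Ordinal _ = 1) ?scale1r; last exact: val_inj.
  by rewrite addrAC (addrr_pchar2 charF) add0r.
case=> xs; first by rewrite -[x]add0r memv_add ?mem0v.
by rewrite -(addrK_pchar2 charF w x) addrC memv_add // memv_line.
Qed.

(** By additivity each recursion step is [L s x * L s (x + w)], and the two factors test the two
    cosets. *)
Lemma subspace_poly_eq0 s x : (L s x == 0) = (x \in <<s>>%VS).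
Proof.
elim: s x => [|w s IHs] x; first by rewrite span_nil memv0.
by rewrite mem_span_cons -!IHs /= subspace_polyD mulf_eq0.
Qed.

Lemma coef_X_neq0 s : (a0 s != 0) = free s.
Proof.
elim: s => [|w s IHs]; first by rewrite oner_eq0 nil_free.
by rewrite free_cons /= mulf_eq0 negb_or IHs subspace_poly_eq0 andbC.
Qed.

Lemma sum_span_cons (f : V -> V) w s : w \notin <<s>>%VS ->
  \sum_(u in <<w :: s>>%VS) f u
  = \sum_(u in <<s>>%VS) f u + \sum_(u in <<s>>%VS) f (u + w).
Proof.
move=> ws; rewrite (bigID [in <<s>>%VS]) /=; congr (_ + _).
  by apply: eq_bigl => u; rewrite mem_span_cons; case: (u \in _); rewrite ?andbF.
rewrite (reindex_inj (addIr w)) /=; apply: eq_bigl => u.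
rewrite mem_span_cons (addrK_pchar2 charF).
case us: (u \in <<s>>%VS); last by rewrite orbF andbN.
by rewrite orbT rpredDl // ws.
Qed.

Lemma sum_inv_coset s x : free s -> x \notin <<s>>%VS ->
  \sum_(u in <<s>>%VS) (u + x)^-1 = a0 s / L s x.
Proof.
elim: s x => [|w s IHs] x.
  move=> _ _; rewrite span_nil (big_pred1 0) ?add0r ?mul1r // => u.
  by rewrite memv0.
rewrite free_cons mem_span_cons negb_or => /andP[ws fs] /andP[xs xws].
rewrite sum_span_cons //= IHs //.
under eq_bigr do rewrite -addrA [w + x]addrC.
rewrite IHs // subspace_polyD.
move: xs xws; rewrite -!subspace_poly_eq0 subspace_polyD => xs xws.
move: (L s x) (L s w) xs xws => p q p0 pq0.
(* Only the numerator [q] is rewritten; what remains is the addition of two fractions with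
   denominators [p] and [p + q], valid in every field. *)
have {2}<- : p + (p + q) = q by rewrite addrA (addrr_pchar2 charF) add0r.
by field; apply/andP.
Qed.

(** The two cosets contribute [a1 s / a0 s] and [a0 s / L s w]. The term [u = 0] adds nothing
    because [0^-1 = 0], in agreement with [f_inv]. *)
Lemma sum_inv_span s : free s -> \sum_(u in <<s>>%VS) u^-1 = a1 s / a0 s.
Proof.
elim: s => [|w s IHs].
  move=> _; rewrite span_nil (big_pred1 0) ?invr0 ?mul0r // => u.
  by rewrite memv0.
rewrite free_cons => /andP[ws fs]; rewrite sum_span_cons // IHs //.
rewrite sum_inv_coset //=.
move: fs ws; rewrite -coef_X_neq0 -subspace_poly_eq0 => fs ws.
by field; apply/andP.
Qed.

Lemma f_invE : @f_inv F =1 GRing.inv.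
Proof. by move=> x; rewrite /f_inv; case: eqVneq => // ->; rewrite invr0. Qed.

Lemma sum_f_inv_affine (U : {vspace V}) (a : V) :
  \sum_(x in [set a + u | u in U]) f_inv (x : F) = \sum_(u in U) (u + a)^-1.
Proof.
rewrite big_imset /=; last by move=> u v _ _; apply: addrI.
by apply: eq_bigr => u _; rewrite f_invE addrC.
Qed.

Lemma sum_coset_mem (U : {vspace V}) (a : V) : a \in U ->
  \sum_(u in U) (u + a)^-1 = \sum_(u in U) u^-1.
Proof.
move=> Ua; rewrite [RHS](reindex_inj (addIr a)) /=.
by apply: eq_bigl => u; rewrite rpredDr.
Qed.

Lemma not_sum_freeP k :
  ~ sum_free charF k (@f_inv F) <->
  exists s : seq V, [/\ size s = k, free s & a1 s = 0].
Proof.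
split=> [not_free|[s [size_s free_s a1s0]] sf]; last first.
  have /sf/eqP[] : affine_subspace charF k [set 0 + u | u in <<s>>%VS].
    by exists 0, <<s>>%VS; split=> //; rewrite -size_s; apply/eqP.
  by rewrite sum_f_inv_affine sum_coset_mem ?mem0v // sum_inv_span // a1s0 mul0r.
(* Tuples over [V] form a finite type, so existence becomes a boolean and admits proof by
   contradiction. *)
suff /existsP[s /and3P[/eqP size_s free_s /eqP a1s0]] :
    [exists s : k.-tuple V, [&& size s == k, free s & a1 s == 0]].
  by exists s.
apply: contraT => /existsPn no_s; case: not_free => A [a [U [dimU ->]]].
rewrite sum_f_inv_affine.
have [spanU freeU] := (span_basis (vbasisP U), basis_free (vbasisP U)).
have a0U : a0 (vbasis U) != 0 by rewrite coef_X_neq0.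
have [Ua|Ua] := boolP (a \in U).
  rewrite sum_coset_mem // -{1}spanU sum_inv_span // mulf_neq0 ?invr_eq0 //.
  rewrite -dimU in no_s.
  by have := no_s (vbasis U); rewrite freeU size_tuple eqxx.
rewrite -{1}spanU sum_inv_coset ?spanU // mulf_neq0 ?invr_eq0 //.
by rewrite subspace_poly_eq0 spanU.
Qed.

(** * The coefficient [a1] in dimensions and codimensions 1 and 2 *)

Context (cardF_gt2 : (2 < #|F|)%N).

(** Multiplication by some [g] other than 0 and 1 permutes the field but scales the sum of all
    inverses by [g^-1], so this sum is 0. *)
Lemma coef_X2_full s : free s -> size s = \dim {: V} -> a1 s = 0.
Proof.
move=> free_s size_s.
have span_s : <<s>>%VS = fullv.
  by apply/eqP; rewrite eqEdim subvf /= -size_s (eqP free_s).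
have := sum_inv_span _ free_s.
rewrite (eq_bigl xpredT) => [|u]; last by rewrite span_s memvf.
move=> sum_all; have : \sum_(u : F) u^-1 = 0.
  have [g g0 g1] : exists2 g : F, g != 0 & g != 1.
    have /subsetPn[g _] : ~~ ([set: F] \subset [set 0; 1]).
      apply: contraL cardF_gt2 => /subset_leq_card.
      by rewrite cardsT cards2 -leqNgt eq_sym oner_eq0.
    by rewrite !inE negb_or => /andP[]; exists g.
  have /eqP := erefl (\sum_(u : F) u^-1).
  rewrite {1}(reindex_inj (mulIf g0)) /= -subr_eq0.
  under eq_bigr do rewrite invfM.
  rewrite -mulr_suml -[X in _ - X]mulr1 -mulrBr mulf_eq0 subr_eq0.
  by rewrite invr_eq1 (negPf g1) orbF => /eqP.
move/(etrans (esym sum_all))/eqP; rewrite mulf_eq0 invr_eq0.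
by rewrite (negPf (_ : a0 s != 0)) ?coef_X_neq0 ?orbF // => /eqP.
Qed.

Lemma free_extend s : free s -> (size s < \dim {: V})%N ->
  exists w, free (w :: s).
Proof.
move=> free_s; rewrite -(eqP free_s) => dim_s.
have /subvPn[w _ ws] : ~~ ({: V} <= <<s>>)%VS.
  by apply: contraL dim_s => /dimvS; rewrite leqNgt.
by exists w; rewrite free_cons ws.
Qed.

Lemma coef_X2_dim1_neq0 s : size s = 1 -> free s -> a1 s != 0.
Proof. by case: s => [|w []] //= _ _; rewrite mul0r mul1r add0r oner_eq0. Qed.

Lemma coef_X2_codim1_neq0 s : (size s).+1 = \dim {: V} -> free s -> a1 s != 0.
Proof.
move=> size_s free_s; have a0s : a0 s != 0 by rewrite coef_X_neq0.
have [w free_ws] : exists w, free (w :: s)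
  by apply: free_extend; rewrite // -size_s.
apply: contraNneq a0s => a1s0.
have /eqP := coef_X2_full _ free_ws size_s.
by rewrite /= a1s0 mul0r add0r mulf_eq0 orbb.
Qed.

(* [F] has no primitive cube root of unity. *)
Context (no_omega : forall x y : F, x * x + x * y + y * y = 0 -> x = 0).

(** For a basis [v], [w], the coefficient [a1] is [v * v + v * w + w * w]. *)
Lemma coef_X2_dim2_neq0 s : size s = 2 -> free s -> a1 s != 0.
Proof.
case: s => [|v [|w []]] //= _; rewrite -coef_X_neq0 /=.
rewrite !mul0r !mul1r !add0r; apply: contraNneq => a1s0.
by rewrite (no_omega w v) ?mul0r // -a1s0; ring.
Qed.

(** If [a1 s = 0], extending by [w] and then [v] to the whole space gives [a1] the value
    [a0 s * a0 s * (c * c + c * d + d * d)]. It vanishes, so [c = L s w] is 0, against the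
    independence of [w]. *)
Lemma coef_X2_codim2_neq0 s : (size s).+2 = \dim {: V} -> free s -> a1 s != 0.
Proof.
move=> size_s free_s; have a0s : a0 s != 0 by rewrite coef_X_neq0.
have [w free_ws] : exists w, free (w :: s)
  by apply: free_extend; rewrite // -size_s.
have [v free_vws] : exists v, free (v :: w :: s)
  by apply: free_extend; rewrite // -size_s.
have := free_ws; rewrite -coef_X_neq0 /=.
apply: contraNneq => a1s0.
have := coef_X2_full _ free_vws size_s; rewrite /= a1s0 mul0r add0r.
set c := L s w; set d := L s v => full.
rewrite (no_omega c d) ?mulr0 //.
have : a0 s * a0 s * (c * c + c * d + d * d) = 0 by rewrite -full; ring.
by move/eqP; rewrite mulf_eq0 mulf_eq0 (negPf a0s) => /eqP.
Qed.
End InverseSums.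

(* A list of bits, lowest degree first, stands for a polynomial over F_2;
   products are reduced modulo X^13 + X^4 + X^3 + X + 1. *)
Fixpoint add_bits (s t : seq bool) : seq bool :=
  match s, t with
  | b :: s', c :: t' => (b (+) c) :: add_bits s' t'
  | [::], _ => t
  | _, [::] => s
  end.

(** Reduction leaves a zero in degree 13; dropping it keeps the lists short in long computations. *)
Fixpoint trim_bits (s : seq bool) : seq bool :=
  if s is b :: s' then
    let t := trim_bits s' in if b || ~~ nilp t then b :: t else [::]
  else [::].

Definition modulus : seq bool :=
  [:: true; true; false; true; true; false; false; false; false; false; false;
      false; false; true].

Definition mulX_bits (s : seq bool) : seq bool :=
  let t := false :: s in
  trim_bits (if nth false t 13 then add_bits t modulus else t).

Definition mul_bits (s t : seq bool) : seq bool :=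
  foldr (fun (b : bool) r => add_bits (if b then t else [::]) (mulX_bits r))
        [::] s.

(** * Evaluation of bit lists at a root of the modulus *)

Section BitsEval.
Context {R : comNzRingType} (charR : 2%N \in [pchar R]) (z : R).

Fixpoint eval_bits (s : seq bool) : R :=
  if s is b :: s' then b%:R + z * eval_bits s' else 0.

Lemma eval_bitsD : {morph eval_bits : s t / add_bits s t >-> s + t}.
Proof.
elim=> [|b s IHs] [|c t] //=; rewrite ?add0r ?addr0 // IHs mulrDr addrACA.
congr (_ + _); case: b c => [] []; rewrite ?addr0 ?add0r //.
by rewrite (addrr_pchar2 charR).
Qed.

Lemma eval_trim_bits s : eval_bits (trim_bits s) = eval_bits s.
Proof.
elim: s => //= b s <-; case: ifP => //= /norP.
by rewrite negbK => -[/negPf -> /nilP ->] /=; rewrite mulr0 addr0.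
Qed.

Lemma eval_zero_bits s : ~~ has id s -> eval_bits s = 0.
Proof. by elim: s => //= -[] s //= IHs /IHs ->; rewrite mulr0 addr0. Qed.

Context (z_root : z ^+ 13 + z ^+ 4 + z ^+ 3 + z + 1 = 0).

Lemma eval_modulus : eval_bits modulus = 0.
Proof. by rewrite -z_root /=; ring. Qed.

Lemma eval_mulX_bits s : eval_bits (mulX_bits s) = z * eval_bits s.
Proof.
rewrite /mulX_bits eval_trim_bits; case: ifP => _; last by rewrite /= add0r.
by rewrite eval_bitsD eval_modulus addr0 /= add0r.
Qed.

Lemma eval_bitsM : {morph eval_bits : s t / mul_bits s t >-> s * t}.
Proof.
elim=> [|b s IHs] t /=; first by rewrite mul0r.
rewrite eval_bitsD eval_mulX_bits IHs mulrDl mulrA.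
by case: b; rewrite ?mul1r ?mul0r.
Qed.

(** Applied to the class of ['X] in the quotient ring by the modulus, this says that the modulus
    divides ['X^(2 ^ 13) - 'X]. *)
Lemma frobenius_13_root : z ^+ (2 ^ 13) = z.
Proof.
pose frob n := iter n (fun s => mul_bits s s) [:: false; true].
have evalX : eval_bits [:: false; true] = z.
  by rewrite /= mulr0 addr0 add0r mulr1.
have eval_frob n : eval_bits (frob n) = z ^+ (2 ^ n).
  elim: n => [|n IHn]; first by rewrite expr1 evalX.
  by rewrite /frob iterS eval_bitsM IHn -expr2 -exprM expnSr.
apply/eqP; rewrite -subr_eq0 (oppr_pchar2 charR) -{2}evalX -eval_frob.
by rewrite -eval_bitsD eval_zero_bits //; vm_compute.
Qed.
End BitsEval.

(** * Two facts about the field with 2^13 elements *)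

Lemma exists_root_13 (F : finFieldType) : #|F| = (2 ^ 13)%N ->
  exists z : F, z ^+ 13 + z ^+ 4 + z ^+ 3 + z + 1 = 0.
Proof.
move=> cardF; have charF := pchar_card2 cardF.
pose P : {poly F} := 'X^13 + ('X^4 + ('X^3 + ('X + 1))).
have size_tail : (size ('X^4 + ('X^3 + ('X + 1)) : {poly F})%R < 14)%N.
  do 2!(apply: leq_ltn_trans (size_polyD _ _) _; rewrite gtn_max size_polyXn /=).
  by rewrite size_XaddC.
have size_P : size P = 14%N by rewrite size_polyDl size_polyXn.
have monic_P : P \is monic.
  by rewrite monicE lead_coefDl ?lead_coefXn // size_polyXn.
have mkP : mk_monic P = P by rewrite /mk_monic size_P monic_P.
have z_root : let z := in_qpoly P 'X in z ^+ 13 + z ^+ 4 + z ^+ 3 + z + 1 = 0.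
  rewrite /= -!rmorphXn -(rmorph1 (in_qpoly P)) -!rmorphD -!addrA -/P.
  by apply/val_inj; rewrite /= mkP Pdiv.RingMonic.rmodpp.
have := frobenius_13_root _ _ z_root.
rewrite pchar_qpoly => /(_ charF)/eqP.
(* The polynomial ['X^#|F| - 'X] is the product of all ['X - x], so its divisor [P] is, up to a
   unit, a product of some of these; as [P] has degree 13, at least one factor occurs. *)
rewrite -rmorphXn -subr_eq0 -rmorphB -cardF finField_genPoly.
move=> /eqP/(congr1 val)/eqP; rewrite /= mkP -/(Pdiv.Ring.rdvdp _ _).
rewrite -Pdiv.Idomain.dvdpE => /dvdp_prod_XsubC[m].
case: (mask _ _) => [|z r] P_prod.
  by have := eqp_size P_prod; rewrite big_nil size_P size_poly1.
exists z; have := eqp_root P_prod z; rewrite big_cons rootM root_XsubC eqxx /=.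
by rewrite /root /P !hornerE => /eqP.
Qed.

Lemma no_omega_13 (F : finFieldType) : #|F| = (2 ^ 13)%N ->
  forall x y : F, x * x + x * y + y * y = 0 -> x = 0.
Proof.
move=> cardF x y xy0; have charF := pchar_card2 cardF.
have cube_eq : x ^+ 3 = y ^+ 3.
  apply/eqP; rewrite -subr_eq0 -[X in _ == X](mulr0 (x - y)) -xy0.
  by apply/eqP; ring.
(* Since 2^13 = 3 * 2730 + 2, equal cubes give [x = c * (x * x)] and [y = c * (y * y)] with the same
   [c]. *)
have expF (t : F) : t = t ^+ 3 ^+ 2730 * (t * t).
  by rewrite -[LHS]expf_card cardF -expr2 -exprM -exprD.
have /eqP : x * y * (x - y) = 0.
  have xE := expF x; have := expF y; rewrite -cube_eq.
  move: (_ ^+ 2730) xE => c xE yE.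
  have xyy : x * (y * y) = y * (x * x).
    transitivity (c * (x * x) * (y * y)); first by rewrite -xE.
    by rewrite mulrAC -yE.
  by transitivity (y * (x * x) - x * (y * y)); [ring | rewrite xyy subrr].
rewrite !mulf_eq0 subr_eq0 -orbA => /or3P[/eqP // | /eqP y0 | /eqP xy].
  by move/eqP: xy0; rewrite y0 !mulr0 !addr0 mulf_eq0 orbb => /eqP.
move/eqP: xy0; rewrite -xy (addrr_pchar2 charF) add0r.
by rewrite mulf_eq0 orbb => /eqP.
Qed.

(** * Verification of explicit bases *)

Definition bits_pow (e : nat) : seq bool := iter e mulX_bits [:: true].

Definition check_basis (es : seq nat) : bool :=
  let bs := map bits_pow es in
  let a := coef_X [:: true] add_bits mul_bits bs in
  (* [a_pow = a ^+ 8191]; it evaluates to 1 iff [a] does not evaluate to 0. *)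
  let a_pow := iter 12 (fun y => mul_bits (mul_bits y y) a) a in
  ~~ has id (add_bits a_pow [:: true])
  && ~~ has id (coef_X2 [::] [:: true] add_bits mul_bits bs).

Lemma check_basisP {F : finFieldType} (charF : 2%N \in [pchar F]) (z : F) es :
  z ^+ 13 + z ^+ 4 + z ^+ 3 + z + 1 = 0 -> check_basis es ->
  exists s : seq (pPrimeCharType charF),
    [/\ size s = size es, free s & coef_X2 0 1 +%R *%R (s : seq F) = 0].
Proof.
move=> z_root /andP[a0_check a1_check].
have evD := eval_bitsD charF z; have evM := eval_bitsM charF z z_root.
have ev1 : eval_bits z [:: true] = 1 by rewrite /= mulr0 addr0.
exists (map (eval_bits z) (map bits_pow es)); split; first by rewrite !size_map.
  rewrite -(coef_X_neq0 charF) -ev1 -(coef_X_morph _ _ _ _ add_bits mul_bits) //.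
  move/eval_zero_bits: a0_check => /(_ _ z)/eqP.
  move: (coef_X _ _ _ _) => a; rewrite evD ev1 -{1}(oppr_pchar2 charF 1).
  (* If [a] evaluated to 0, so would the iterate, whose outermost factor is [a]; but it evaluates to
     1. *)
  rewrite subr_eq0; apply: contraTneq => a0.
  by rewrite iterS evM a0 mulr0 eq_sym oner_eq0.
rewrite -ev1 -[0]/(eval_bits z [::]).
by rewrite -(coef_X2_morph _ _ _ _ _ add_bits mul_bits) // eval_zero_bits.
Qed.

Theorem theorem3p1 (F : finFieldType) (cardF : #|F| = (2 ^ 13)%N) (k : nat) :
  in_K cardF k <-> (3 <= k <= 10)%N.
Proof.
have charF := pchar_card2 cardF.
have dimF : \dim {: pPrimeCharType (pchar_card2 cardF)} = 13.
  by rewrite pprimeChar_dimf [X in logn _ X]cardF pfactorK.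
have F_gt2 : (2 < #|F|)%N by rewrite cardF (ltn_exp2l 1).
have no_omega := no_omega_13 _ cardF.
rewrite /in_K not_sum_freeP; split.
  case=> /andP[k_gt0 k_le12] [s [size_s free_s /eqP a1s0]].
  rewrite !ltnNge; apply: contraTT a1s0 => k_out.
  have : k \in [:: 1; 2; 11; 12]%N.
    by move: k k_gt0 k_le12 k_out {size_s}; do 13?case=> //.
  rewrite !inE => /or4P[] /eqP k_eq; rewrite k_eq in size_s.
  - exact: coef_X2_dim1_neq0.
  - exact: coef_X2_dim2_neq0.
  - by apply: coef_X2_codim2_neq0 => //; rewrite size_s dimF.
  - by apply: coef_X2_codim1_neq0 => //; rewrite size_s dimF.
move=> /andP[k_ge3 k_le10]; split.
  by rewrite (leq_trans _ k_ge3) ?(leq_trans k_le10).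
have [z z_root] := exists_root_13 _ cardF.
(* Each number [e] stands for the basis vector [z ^+ e]; the lists have lengths 3 to 10, whence the
   index [k - 3]. *)
pose bases := [:: [:: 206; 127; 0]; [:: 30; 9; 6; 0]; [:: 26; 13; 10; 2; 0];
  [:: 19; 15; 14; 8; 3; 0]; [:: 19; 16; 9; 8; 3; 2; 0];
  [:: 18; 14; 11; 10; 9; 6; 3; 0]; [:: 15; 12; 10; 8; 7; 5; 3; 1; 0];
  [:: 20; 18; 16; 12; 10; 7; 5; 3; 1; 0]]%N.
have [es size_es es_ok] : exists2 es, size es = k & check_basis es.
  exists (nth [::] bases (k - 3)).
    by move: k k_ge3 k_le10; do 11?case=> //.
  have /(all_nthP [::]) : all check_basis bases by vm_compute.
  by apply; rewrite ltn_subLR.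
by rewrite -size_es; apply: check_basisP z_root es_ok.
Qed.
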